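(* Let $(A,\mathfrak{m})$ be a Noetherian local ring and let $\mathfrak{D}$ be a set of derivations of $A$. Let $I$ be a maximally $\mathfrak{D}$-differential ideal in $A$. Let $n=\operatorname{emdim}(A)$ and $r=\operatorname{emdim}(A/I)$. If $A/I$ is of characteristic $p>0$, then there exists a minimal set $\{x_1,x_2,\dots,x_n\}$ of generators of $\mathfrak{m}$ such that $I=(x_1^p,\dots,x_r^p,x_{r+1},\dots,x_n)$.
   Context: All rings are commutative with unity. For a Noetherian local ring $(B,\mathfrak{n})$, $\operatorname{emdim}(B)$ denotes its embedding dimension, i.e. the minimal number of generators of the maximal ideal $\mathfrak{n}$. A derivation of a ring $A$ is an additive endomorphism $d$ of $A$ such that $d(ab)=a\,d(b)+b\,d(a)$ for all $a,b\in A$. For a set $\mathfrak{D}$ of derivations of $A$, an ideal $I$ of $A$ is $\mathfrak{D}$-differential if $d(I)\subseteq I$ for all $d\in\mathfrak{D}$. An ideal $I$ is maximally $\mathfrak{D}$-differential if it is a proper $\mathfrak{D}$-differential ideal and no ideal $J$ of $A$ with $I\subsetneq J\subsetneq A$ is $\mathfrak{D}$-differential. *)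

(* Defs.v *)
From HB Require Import structures.
From mathcomp Require Import all_boot all_algebra.
From mathcomp Require Import boolp classical_sets functions cardinality.

Set Implicit Arguments.
Unset Strict Implicit.
Unset Printing Implicit Defensive.

Import GRing.Theory.

Local Open Scope classical_set_scope.
Local Open Scope ring_scope.

(* The predicates [idealr_closed] and [idealr] of ring_quotient.v only describe
   proper ideals; [is_ideal] also allows the whole ring. *)
Definition is_ideal (B : comNzRingType) (J : set B) : Prop :=
  [/\ J 0,
      (forall a b, J a -> J b -> J (a + b)) &
      (forall a b, J b -> J (a * b))].

Definition ideal_gen (B : comNzRingType) (S : set B) : set B :=
  smallest (@is_ideal B) S.

Definition noetherian (B : comNzRingType) : Prop :=
  forall J : set B, is_ideal J ->
    exists S : set B, finite_set S /\ ideal_gen S = J.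

Definition maximal_ideal (B : comNzRingType) (M : set B) : Prop :=
  [/\ is_ideal M, M <> setT &
      (forall J, is_ideal J -> M `<=` J -> J = M \/ J = setT)].

Definition local_ring (B : comNzRingType) (M : set B) : Prop :=
  forall M' : set B, maximal_ideal M' <-> M' = M.

Definition generated_by_n (B : comNzRingType) (J : set B) (k : nat) : Prop :=
  exists x : 'I_k -> B, ideal_gen (range x) = J.

(* The default value 0 is only used when J is not finitely generated. *)
Definition min_number_gens (B : comNzRingType) (J : set B) : nat :=
  xget 0%N [set k | generated_by_n J k /\
                    forall j, generated_by_n J j -> (k <= j)%N].

(* Meaningful for a Noetherian local ring B, where [xget] picks the unique
   maximal ideal of B. *)
Definition emdim (B : comNzRingType) : nat :=
  min_number_gens (xget set0 (@maximal_ideal B)).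

Definition minimal_gen_set (B : comNzRingType) (J S : set B) : Prop :=
  ideal_gen S = J /\ forall T, T `<` S -> ideal_gen T <> J.

(* The characteristic as the nonnegative generator of the kernel of Z -> B; it
   is not required to be prime, unlike p in [p \in [pchar B]]. *)
Definition has_char (B : comNzRingType) (p : nat) : Prop :=
  forall k : nat, (k%:R = 0 :> B) <-> (p %| k)%N.

Definition is_derivation (A : comNzRingType) (d : {additive A -> A}) : Prop :=
  forall a b : A, d (a * b) = a * d b + b * d a.

Definition differential (A : comNzRingType) (D : set {additive A -> A})
    (J : set A) : Prop :=
  forall d, D d -> d @` J `<=` J.

Definition maximally_differential (A : comNzRingType)
    (D : set {additive A -> A}) (I : set A) : Prop :=
  [/\ is_ideal I, I <> setT, differential D I &
      (forall J, is_ideal J -> I `<` J -> J `<` setT -> ~ differential D J)].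

(* Main.v *)
Require Import Defs.
From HB Require Import structures.
From mathcomp Require Import all_boot all_algebra.
From mathcomp Require Import boolp classical_sets functions cardinality.
From mathcomp Require Import ring.

(** Put [B = A/I]. Maximality of [I] says that no ideal of [B] other than [0] and
    [B] is stable under all derivations of [B]. Two consequences are immediate.
    A prime factor [q] of the characteristic generates a stable ideal, so the
    characteristic [p] is prime; and for a nonunit [y] the ideal [y^p B] is
    stable because [d (y^p) = p y^(p-1) d y = 0], so [y^p = 0]. Let
    [x_1, ..., x_n] be minimal generators of [m] such that [x_1, ..., x_r] give
    minimal generators of the maximal ideal [N] of [B], and the remaining ones
    lie in [I] ([adapted_generators]). Then
    [H = (x_1^p, ..., x_r^p, x_(r+1), ..., x_n)] is contained in [I], and the
    point is the converse: the images of [x_1, ..., x_r] in [B] must satisfy no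
    relations beyond [x_i^p = 0].

    The idea is to adjoin the [x_i] to the zero ideal of [B] one at a time, in
    an order chosen by derivations. Suppose [K], generated by some of the [x_i],
    is differentially simple: no proper ideal strictly above [K] is stable under
    all derivations preserving [K]. If [K <> N], then [N] is not stable, so some
    derivation [d] preserving [K] sends some [x_i] to a unit, and after scaling
    [d x_i = 1]. Put [y = x_i]. Two things happen. First, [K + y B] is again
    differentially simple ([diff_simple_adjoin]), so the process continues
    until it reaches [N]. Second, [y] behaves modulo [K] like a variable
    truncated at order [p]: [y^j f] in [K] with [j < p] forces [f] into
    [K + y B] ([adjoin_colon]). When the chain reaches [N], minimality of the
    generators implies that all of [x_1, ..., x_r] have been adjoined; number
    them in this order.

    The second property yields [I = H] by descending the chain
    [0 = K_0 < K_1 < ... < K_r = N]. Let [H_s] be generated by the [x_i] already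
    adjoined in [K_s], the [p]-th powers of the others among [x_1, ..., x_r],
    and [x_(r+1), ..., x_n]. The preimage of [K_r] is [m = H_r]. If the preimage
    of [K_(s+1)] is [H_(s+1)], which lies in [H_s + y A], then any [f] in the
    preimage of [K_s] is [g + y c] with [g] in [H_s]; now [y c] lies in that
    preimage, so [c] can be expanded in the same way, and so on until [f] lies
    in [H_s + y^p A = H_s] ([colon_expansion], [regular_chain_kernel]). At
    [s = 0] this says that [I] is contained in [H]. *)

Set Implicit Arguments.
Unset Strict Implicit.
Unset Printing Implicit Defensive.

Import GRing.Theory.

Local Open Scope classical_set_scope.
Local Open Scope ring_scope.

(** * Ideals *)

Lemma ideal_zero (B : comNzRingType) (J : set B) : is_ideal J -> J 0.
Proof. by case. Qed.

Lemma ideal_add (B : comNzRingType) (J : set B) a b :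
  is_ideal J -> J a -> J b -> J (a + b).
Proof. by case=> _ + _; exact. Qed.

Lemma ideal_mull (B : comNzRingType) (J : set B) a b :
  is_ideal J -> J b -> J (a * b).
Proof. by case=> _ _; exact. Qed.

Lemma ideal_mulr (B : comNzRingType) (J : set B) a b :
  is_ideal J -> J a -> J (a * b).
Proof. by rewrite mulrC; exact: ideal_mull. Qed.

Lemma ideal_opp (B : comNzRingType) (J : set B) a : is_ideal J -> J a -> J (- a).
Proof. by move=> iJ Ja; rewrite -mulN1r; exact: ideal_mull. Qed.

Lemma ideal_sub (B : comNzRingType) (J : set B) a b :
  is_ideal J -> J a -> J b -> J (a - b).
Proof. by move=> iJ Ja Jb; apply: ideal_add => //; exact: ideal_opp. Qed.

Lemma ideal_top (B : comNzRingType) (J : set B) : is_ideal J -> J 1 -> J = setT.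
Proof.
move=> iJ J1; apply/seteqP; split=> // a _.
by rewrite -[a]mulr1; exact: ideal_mull.
Qed.

Lemma ideal_proper (B : comNzRingType) (J : set B) :
  is_ideal J -> J <> setT -> ~ J 1.
Proof. by move=> iJ JT /(ideal_top iJ). Qed.

Lemma zero_ideal (B : comNzRingType) : is_ideal [set 0 : B].
Proof.
by split=> [//|a b /= -> ->|a b /= ->]; rewrite ?addr0 ?mulr0.
Qed.

Lemma zero_ideal_sub (B : comNzRingType) (J : set B) :
  is_ideal J -> [set 0] `<=` J.
Proof. by move=> iJ _ ->; exact: ideal_zero. Qed.

Lemma ideal_gen_ideal (B : comNzRingType) (S : set B) : is_ideal (ideal_gen S).
Proof.
split=> [J [iJ _]|a b Sa Sb J [iJ SJ]|a b Sb J [iJ SJ]].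
- exact: ideal_zero.
- by apply: ideal_add => //; [apply: Sa|apply: Sb].
- by apply: ideal_mull => //; apply: Sb.
Qed.

Lemma sub_ideal_gen (B : comNzRingType) (S : set B) : S `<=` ideal_gen S.
Proof. exact: sub_gen_smallest. Qed.

Lemma ideal_gen_min (B : comNzRingType) (S J : set B) :
  is_ideal J -> S `<=` J -> ideal_gen S `<=` J.
Proof. exact: smallest_sub. Qed.

Lemma ideal_gen_sub (B : comNzRingType) (S S' : set B) :
  S `<=` S' -> ideal_gen S `<=` ideal_gen S'.
Proof.
move=> SS'; apply: ideal_gen_min; first exact: ideal_gen_ideal.
by apply: subset_trans SS' _; exact: sub_ideal_gen.
Qed.

Definition adjoin (B : comNzRingType) (K : set B) (y : B) : set B :=
  [set a | exists k c, K k /\ a = k + c * y].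

Lemma adjoin_ideal (B : comNzRingType) (K : set B) y :
  is_ideal K -> is_ideal (adjoin K y).
Proof.
move=> iK; split.
- by exists 0, 0; split; [exact: ideal_zero|rewrite mul0r addr0].
- move=> _ _ [k [c [Kk ->]]] [k' [c' [Kk' ->]]].
  by exists (k + k'), (c + c'); split; [exact: ideal_add|ring].
- move=> a _ [k [c [Kk ->]]].
  by exists (a * k), (a * c); split; [exact: ideal_mull|ring].
Qed.

Lemma sub_adjoin (B : comNzRingType) (K : set B) y : K `<=` adjoin K y.
Proof. by move=> k Kk; exists k, 0; rewrite mul0r addr0. Qed.

Lemma adjoinM (B : comNzRingType) (K : set B) y c :
  is_ideal K -> adjoin K y (c * y).
Proof.
by move=> iK; exists 0, c; rewrite add0r; split=> //; exact: ideal_zero.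
Qed.

Lemma adjoin_self (B : comNzRingType) (K : set B) y : is_ideal K -> adjoin K y y.
Proof. by move=> iK; rewrite -{2}[y]mul1r; exact: adjoinM. Qed.

Lemma adjoin_min (B : comNzRingType) (K J : set B) y :
  is_ideal J -> K `<=` J -> J y -> adjoin K y `<=` J.
Proof.
move=> iJ KJ Jy _ [k [c [Kk ->]]].
by apply: ideal_add => //; [exact: KJ|exact: ideal_mull].
Qed.

(** * Derivations *)

(** Unlike [is_derivation], a predicate on bare functions, so that sums,
    commutators and iterates of derivations can be formed directly. *)
Definition derivation (B : comNzRingType) (d : B -> B) : Prop :=
  {morph d : a b / a + b} /\ forall a b, d (a * b) = a * d b + b * d a.

Definition stable (B : comNzRingType) (d : B -> B) (J : set B) : Prop :=
  forall a, J a -> J (d a).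

Lemma der0 (B : comNzRingType) (d : B -> B) : derivation d -> d 0 = 0.
Proof. by case=> dD _; apply: (addrI (d 0)); rewrite -dD !addr0. Qed.

Lemma der1 (B : comNzRingType) (d : B -> B) : derivation d -> d 1 = 0.
Proof.
case=> _ dM; apply: (addrI (d 1)).
by rewrite addr0 -[in RHS](mulr1 1) dM mul1r.
Qed.

Lemma derX (B : comNzRingType) (d : B -> B) y k :
  derivation d -> d (y ^+ k.+1) = k.+1%:R * y ^+ k * d y.
Proof.
move=> dd; elim: k => [|k IH]; first by rewrite expr0 !mul1r.
by rewrite exprS dd.2 IH -[k.+2]addn1 natrD exprS; ring.
Qed.

Lemma iter_der0 (B : comNzRingType) (d : B -> B) i :
  derivation d -> iter i d 0 = 0.
Proof. by move=> dd; elim: i => //= i ->; rewrite der0. Qed.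

Lemma iter_derD (B : comNzRingType) (d : B -> B) i a b :
  derivation d -> iter i d (a + b) = iter i d a + iter i d b.
Proof. by move=> dd; elim: i => //= i ->; rewrite dd.1. Qed.

Lemma derivation_scale (B : comNzRingType) (d : B -> B) c :
  derivation d -> derivation (fun a => c * d a).
Proof. by case=> dD dM; split=> a b; rewrite ?dD ?dM; ring. Qed.

Lemma derivation_sub (B : comNzRingType) (d e : B -> B) :
  derivation d -> derivation e -> derivation (fun a => d a - e a).
Proof. by move=> [dD dM] [eD eM]; split=> a b; rewrite ?dD ?dM ?eD ?eM; ring. Qed.

Lemma derivation_comm (B : comNzRingType) (d e : B -> B) :
  derivation d -> derivation e -> derivation (fun a => d (e a) - e (d a)).
Proof.
by move=> [dD dM] [eD eM]; split=> a b; rewrite !(eD, eM, dD, dM); ring.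
Qed.

Lemma iter_Leibniz (B : comNzRingType) (d : B -> B) n a b : derivation d ->
  iter n d (a * b) =
    \sum_(i < n.+1) (iter (n - i) d a * iter i d b) *+ 'C(n, i).
Proof.
move=> dd; have dMn x k : d (x *+ k) = d x *+ k.
  by elim: k => [|k IH]; rewrite ?der0 // !mulrS dd.1 IH.
elim: n => [|n IH]; first by rewrite big_ord_recl big_ord0 addr0 bin0.
rewrite iterS IH (big_morph d dd.1 (der0 dd)).
rewrite big_ord_recl [RHS]big_ord_recl /= !bin0 !subn0 mulr1n dd.2 /=.
rewrite (eq_bigr (fun i : 'I_n =>
   (iter (n - i) d a * iter i.+1 d b) *+ 'C(n, i.+1) +
   (iter (n - i.+1) d a * iter i.+2 d b) *+ 'C(n, i.+1))); last first.
  move=> i _; rewrite dMn dd.2 /= /bump leq0n add1n -iterS.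
  rewrite -(subnSK (ltn_ord i)) mulrnDl addrC; congr (_ + _).
  by rewrite mulrC.
under [in RHS]eq_bigr => i _ do
  rewrite /bump leq0n add1n subSS binS mulrnDr.
rewrite !big_split /= [X in _ = _ + (X + _)]big_ord_recr /=.
rewrite bin_small // mulr0n addr0.
rewrite [X in _ = _ + (_ + X)]big_ord_recl /= bin0 subn0 mulr1n /bump.
rewrite mulr1n [b * _]mulrC [X in X + _]addrC -addrA; congr (_ + _).
by rewrite addrCA.
Qed.

(** In the Leibniz formula for [d^p] every binomial coefficient but the first
    and the last is divisible by [p]. *)
Lemma derivation_iter_prime (B : comNzRingType) (d : B -> B) p :
  prime p -> p%:R = 0 :> B -> derivation d -> derivation (iter p d).
Proof.
move=> p_pr p0 dd; split=> a b; first exact: iter_derD.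
case: p p_pr p0 => // p p_pr p0.
rewrite iter_Leibniz // big_ord_recl big_ord_recr /= bin0 mulr1n.
rewrite /bump leq0n add1n subnn binn mulr1n /= big1 ?add0r => [|i _]; last first.
  have /dvdnP[q ->] : (p.+1 %| 'C(p.+1, bump 0 i))%N.
    by rewrite prime_dvd_bin // /bump /= add1n ltnS.
  by rewrite mulrnA -mulr_natr p0 mulr0.
by rewrite addrC [in X in _ + X]mulrC.
Qed.

Lemma fact_unit (B : comNzRingType) p k :
  prime p -> p%:R = 0 :> B -> (k < p)%N -> exists c : B, k`!%:R * c = 1.
Proof.
move=> p_pr p0; elim: k => [|k IH] kp; first by exists 1; rewrite mulr1.
have [c kc] := IH (ltnW kp).
have [u _ /dvdnP[q uq]] := Bezoutl p (ltn0Sn k).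
have /eqP gk : coprime k.+1 p by rewrite coprime_sym prime_coprime // gtnNdvd.
exists (c * q%:R).
have qk : q%:R * k.+1%:R = 1 :> B.
  by rewrite -natrM -uq gk natrD natrM p0 mulr0 addr0.
rewrite factS natrM.
transitivity ((k`!%:R * c) * (q%:R * k.+1%:R) : B); first by ring.
by rewrite kc qk mulr1.
Qed.

(** * Differentially simple ideals *)

(** Differential simplicity of [B/K], with respect to those derivations of
    [B/K] that lift to [B]. Working with derivations of [B] keeps the ring fixed
    while [K] grows along a chain. *)
Definition diff_simple (B : comNzRingType) (K : set B) : Prop :=
  [/\ is_ideal K, ~ K 1 &
      forall J, is_ideal J -> K `<=` J ->
        (forall d, derivation d -> stable d K -> stable d J) ->
        J `<=` K \/ J 1].

(** A nonunit [y] gives the ideal [y^p B], which every derivation preserves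
    since [d (y^p) = p y^(p-1) d y = 0]. *)
Lemma simple_expp (B : comNzRingType) (p : nat) (n : set B) (y : B) :
  p%:R = 0 :> B -> (0 < p)%N -> diff_simple [set 0 : B] ->
  is_ideal n -> ~ n 1 -> n y -> y ^+ p = 0.
Proof.
move=> p0 p_gt0 [z_id _ simp] n_id n1 ny.
have yp_n : n (y ^+ p).
  by rewrite -(prednK p_gt0) exprS; apply: (ideal_mulr _ n_id).
case: (simp (adjoin [set 0] (y ^+ p))) => [||d dd _|sub0|].
- exact: adjoin_ideal.
- exact: sub_adjoin.
- move=> _ [_ [c [-> ->]]]; rewrite add0r dd.2.
  case: p p0 p_gt0 {yp_n} => // p p0 _.
  by rewrite derX // p0 !mul0r mulr0 add0r mulrC; exact: adjoinM.
- by apply: sub0; exact: adjoin_self.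
- by move=> /(adjoin_min n_id (zero_ideal_sub n_id) yp_n).
Qed.

Lemma iter_der_expM (B : comNzRingType) (d : B -> B) (y g : B) k :
  derivation d -> d y = 1 ->
  exists h, iter k d (y ^+ k * g) = k`!%:R * g + h * y.
Proof.
move=> dd dy; elim: k g => [|k IH] g.
  by exists 0; rewrite fact0 !mul1r mul0r addr0.
have [h eh] := IH (k.+1%:R * g + y * d g).
exists (h + k`!%:R * d g); rewrite iterSr dd.2 derX // dy.
transitivity (iter k d (y ^+ k * (k.+1%:R * g + y * d g))).
  by congr (iter k d _); rewrite exprS; ring.
by rewrite eh factS natrM; ring.
Qed.

(** Taylor correction: subtracting [y^k d^k f / k!] from [f] kills the [k]-th
    derivative modulo [y] and leaves the earlier ones unchanged modulo [y]. *)
Lemma taylor_correction (B : comNzRingType) (p : nat) (J : set B) (d : B -> B)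
    (y f : B) k :
  prime p -> p%:R = 0 :> B -> is_ideal J -> derivation d -> d y = 1 ->
  J y -> J f -> (k <= p)%N ->
  exists c, forall j, (j < k)%N -> J (iter j d (f + c * y)).
Proof.
move=> p_pr p0 J_id dd dy Jy Jf; elim: k => [|k IH] kp; first by exists 0.
have [c Jc] := IH (ltnW kp); set g := f + c * y in Jc.
case: k => [|k] in IH kp Jc *.
  (* The derivative of order 0 of f is f itself, which already lies in J. *)
  exists 0 => -[|//] _ /=; rewrite mul0r addr0; exact: Jf.
have [v kv] := fact_unit p_pr p0 kp.
set e := - (v * iter k.+1 d g).
exists (c + e * y ^+ k) => j; rewrite ltnS => jk.
have -> : f + (c + e * y ^+ k) * y = g + y ^+ k.+1 * e.
  by rewrite /g exprS; ring.
rewrite iter_derD //; move: jk; rewrite leq_eqVlt => /orP[/eqP->|jk].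
  have [h ->] := iter_der_expM e k.+1 dd dy.
  rewrite /e mulrN mulrA kv mul1r addrA subrr add0r.
  exact: ideal_mull.
apply: ideal_add => //; first exact: Jc.
rewrite -(subnKC (ltnW jk)) exprD -mulrA.
have [h ->] := iter_der_expM (y ^+ (k.+1 - j) * e) j dd dy.
apply: ideal_add => //; last exact: ideal_mull.
apply: ideal_mull => //; rewrite -(subnSK jk) exprS -mulrA.
exact: ideal_mulr.
Qed.

(** If [J] contains [K + y B] and is stable under the derivations preserving
    [K + y B], then the elements of [J] all of whose iterated derivatives stay
    in [J] form an ideal stable under the derivations preserving [K], so this
    ideal is [K] or [B]. That it represents all of [J] modulo [y] is the Taylor
    correction; derivatives of order at least [p] are harmless because [d^p]
    is a derivation killing [y]. *)
Lemma diff_simple_adjoin (B : comNzRingType) (p : nat) (K n : set B)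
    (d : B -> B) (y : B) :
  prime p -> p%:R = 0 :> B -> is_ideal n -> ~ n 1 -> K `<=` n -> n y ->
  diff_simple K -> derivation d -> stable d K -> d y = 1 ->
  diff_simple (adjoin K y).
Proof.
move=> p_pr p0 n_id n1 Kn ny [K_id K1 simp] dd dK dy.
split; first exact: adjoin_ideal.
  by move=> /(adjoin_min n_id Kn ny).
move=> J0 J0_id KyJ0 stabJ0.
have KJ0 : K `<=` J0 by apply: subset_trans KyJ0; exact: sub_adjoin.
have J0y : J0 y by apply: KyJ0; exact: adjoin_self.
(* A derivation that preserves K and kills y also preserves K + y B. *)
have J0_stab e : derivation e -> stable e K -> e y = 0 -> stable e J0.
  move=> de eK ey; apply: stabJ0 => // _ [k [c [Kk ->]]].
  rewrite de.1 de.2 ey mulr0 add0r mulrC.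
  by exists (e k), (e c); split=> //; exact: eK.
pose J := [set f | forall i, J0 (iter i d f)].
have J_d f : J f -> J (d f) by move=> Jf i; rewrite -iterSr; exact: Jf.
have J_add a b : J a -> J b -> J (a + b).
  by move=> Ja Jb i; rewrite iter_derD //; apply: ideal_add.
have J_mul a f : J f -> J (a * f).
  move=> Jf i; elim: i => [|i IH] in a f Jf *.
    by apply: ideal_mull => //; exact: (Jf 0%N).
  rewrite iterSr dd.2 iter_derD //; apply: ideal_add => //.
    by apply: IH; exact: J_d.
  by rewrite mulrC; apply: IH.
have J_id : is_ideal J.
  by split=> // i; rewrite iter_der0 //; exact: ideal_zero.
have J_kill e : derivation e -> stable e K -> e y = 0 -> stable e J.
  move=> de eK ey f Jf i; elim: i => [|i IH] in e de eK ey f Jf *.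
    by apply: (J0_stab e) => //; exact: (Jf 0%N).
  (* Move d past e; the commutator of d and e kills y as well. *)
  rewrite iterSr -[d (e f)](subrKC (e (d f))) iter_derD //.
  apply: ideal_add => //; first by apply: IH => //; exact: J_d.
  apply: (IH (fun a => d (e a) - e (d a))) => //.
  - exact: derivation_comm.
  - move=> a Ka; apply: ideal_sub => //; first by apply: dK; exact: eK.
    by apply: eK; exact: dK.
  - by rewrite ey dy der0 // der1 // subr0.
have KJ : K `<=` J.
  move=> k Kk i; apply: KJ0; elim: i => //= i; exact: dK.
case: (simp J J_id KJ) => [e de eK f Jf|JK|J1].
- (* Subtracting a multiple of d reduces e to a derivation killing y. *)
  have -> : e f = (e f - e y * d f) + e y * d f by rewrite subrK.
  apply: J_add; last by apply: J_mul; exact: J_d.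
  apply: (J_kill (fun a => e a - e y * d a)) => //.
  + by apply: derivation_sub => //; exact: derivation_scale.
  + move=> a Ka; apply: ideal_sub => //; first exact: eK.
    by apply: ideal_mull => //; exact: dK.
  + by rewrite dy mulr1 subrr.
- left=> f J0f.
  have [c Jc] := taylor_correction p_pr p0 J0_id dd dy J0y J0f (leqnn p).
  suff /JK Kg : J (f + c * y) by exists (f + c * y), (- c); split=> //; ring.
  move=> i; have [k] := ubnP i; elim: k i => // k IH i ik.
  have [/Jc //|pi] := ltnP i p; rewrite -(subnKC pi) iterD.
  apply: (J0_stab (iter p d)); last 1 first.
  + apply: IH; move: ik; rewrite ltnS; apply: leq_trans.
    by rewrite ltn_subrL prime_gt0 // (leq_trans (prime_gt0 p_pr)).
  + exact: derivation_iter_prime.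
  + by move=> a Ka; elim: (p) => //= j; exact: dK.
  + case: p p_pr {p0 Jc pi} => [|[|p]] // _.
    by rewrite !iterSr dy der1 // iter_der0.
- by right; exact: (J1 0%N).
Qed.

(** Applying [d] to [y^(j+1) f] lowers the exponent of [y] by one, replacing [f]
    with [(j+1) f + y d f]; the factor [j + 1] is invertible when [j + 1 < p]. *)
Lemma adjoin_colon (B : comNzRingType) (p : nat) (K : set B) (d : B -> B)
    (y f : B) j :
  prime p -> p%:R = 0 :> B -> is_ideal K -> derivation d -> stable d K ->
  d y = 1 -> (j < p)%N -> K (y ^+ j * f) -> adjoin K y f.
Proof.
move=> p_pr p0 K_id dd dK dy; elim: j f => [|j IH] f jp.
  by rewrite mul1r; exact: sub_adjoin.
move=> /dK; rewrite dd.2 derX // dy mulr1 exprS => Kf.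
have /IH : K (y ^+ j * (j.+1%:R * f + y * d f)).
  by move: Kf; congr K; ring.
move=> /(_ (ltnW jp)) af.
have [v jv] := fact_unit p_pr p0 jp.
have aK := adjoin_ideal y K_id.
have -> : f = (v * j`!%:R) * (j.+1%:R * f + y * d f - d f * y).
  transitivity ((j.+1)`!%:R * v * f); first by rewrite jv mul1r.
  by rewrite factS natrM; ring.
by apply: ideal_mull => //; apply: ideal_sub => //; exact: adjoinM.
Qed.

(** An iterated [adjoin] instead of an [ideal_gen], because [p_regular] depends on
    the order of the generators. *)
Fixpoint chain (B : comNzRingType) (T : Type) (b : T -> B) (s : seq T) : set B :=
  if s is i :: s' then adjoin (chain b s') (b i) else [set 0].

(** The trace left by the derivations: at each link of the chain, the powers of
    the new generator below the [p]-th multiply like those of a variable. It is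
    the analogue of a regular sequence for truncated polynomial rings. *)
Fixpoint p_regular (B : comNzRingType) (T : Type) (p : nat) (b : T -> B)
    (s : seq T) : Prop :=
  if s is i :: s' then
    (forall j f, (j < p)%N -> chain b s' (b i ^+ j * f) -> chain b s f)
    /\ p_regular p b s'
  else True.

Lemma chain_ideal (B : comNzRingType) (T : Type) (b : T -> B) s :
  is_ideal (chain b s).
Proof.
by elim: s => [|i s IH]; [exact: zero_ideal|exact: adjoin_ideal].
Qed.

Lemma chain_mem (B : comNzRingType) (T : eqType) (b : T -> B) s i :
  i \in s -> chain b s (b i).
Proof.
elim: s => //= j s IH; rewrite in_cons => /orP[/eqP->|/IH].
  by apply: adjoin_self; exact: chain_ideal.
exact: sub_adjoin.
Qed.

Lemma chain_min (B : comNzRingType) (T : eqType) (b : T -> B) s (J : set B) :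
  is_ideal J -> (forall i, i \in s -> J (b i)) -> chain b s `<=` J.
Proof.
move=> J_id; elim: s => [|i s IH] Jb; first by move=> _ ->; exact: ideal_zero.
apply: adjoin_min => //; last by apply: Jb; rewrite mem_head.
by apply: IH => j js; apply: Jb; rewrite in_cons js orbT.
Qed.

(** As long as the chain has not reached [n], differential simplicity provides
    a derivation preserving the chain and not [n]. It sends some generator
    [b i] to a unit, which can be scaled to [1]; this [b i] extends the
    chain. *)
Lemma p_regular_chain (B : comNzRingType) (T : finType) (p : nat) (n : set B)
    (b : T -> B) :
  prime p -> p%:R = 0 :> B -> diff_simple [set 0 : B] ->
  is_ideal n -> ~ n 1 -> (forall a, ~ n a -> exists c, a * c = 1) ->
  ideal_gen (range b) = n ->
  exists s, [/\ uniq s, p_regular p b s & chain b s = n].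
Proof.
move=> p_pr p0 simp0 n_id n1 n_unit gen_b.
have nb i : n (b i) by rewrite -gen_b; apply: sub_ideal_gen; exists i.
have chain_n s : chain b s `<=` n by apply: chain_min.
suff H k : exists s, [/\ uniq s, p_regular p b s, diff_simple (chain b s) &
    chain b s = n \/ size s = k].
  have [s [us rs _ [sn|ss]]] := H #|T|.+1; first by exists s.
  have := uniq_leq_size us (fun i _ => mem_enum T i).
  by rewrite -cardE ss ltnn.
elim: k => [|k [s [us rs ss [sn|sk]]]].
- by exists [::]; split=> //; right.
- by exists s; split=> //; left.
have [sn|sn] := pselect (chain b s = n); first by exists s; split=> //; left.
have [d [dd dK [i ndi]]] : exists d, [/\ derivation d, stable d (chain b s) &
    exists i, ~ n (d (b i))].
  apply: contrapT => nod; case: ss => _ _ /(_ n n_id (chain_n s)) [|nK|//].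
    move=> d dd dK; apply: contrapT => ndn; apply: nod; exists d; split=> //.
    apply: contrapT => /forallNP nob; apply: ndn => a na.
    suff : [set z | n z /\ n (d z)] a by case.
    move: a na; rewrite -{1}gen_b; apply: ideal_gen_min.
      split; first by rewrite /= der0 //; split; exact: ideal_zero.
        by move=> x z [nx ndx] [nz ndz]; rewrite /= dd.1; split; exact: ideal_add.
      move=> x z [nz ndz]; rewrite /= dd.2; split; first exact: ideal_mull.
      by apply: ideal_add => //; [exact: ideal_mull|exact: ideal_mulr].
    by move=> _ [i _ <-]; split=> //; exact: contrapT (nob i).
  by apply: sn; apply/seteqP; split.
have [u du] := n_unit _ ndi.
have dd' := derivation_scale u dd.
have d'y : u * d (b i) = 1 by rewrite mulrC.
have d'K : stable (fun a => u * d a) (chain b s).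
  by move=> a Ka; apply: ideal_mull; [exact: chain_ideal|exact: dK].
exists (i :: s); split=> /=.
- rewrite us andbT; apply/negP => /(@chain_mem _ _ b) /dK /chain_n; exact: ndi.
- split=> // j f jp.
  by apply: adjoin_colon dd' d'K d'y jp => //; exact: chain_ideal.
- exact: (diff_simple_adjoin p_pr p0 n_id n1 (chain_n s) (nb i) ss dd' d'K d'y).
- by right; rewrite sk.
Qed.

(** * Generators of the kernel *)

(** Write [f] in [K] as [g + c y^j] and apply the colon hypothesis to [c],
    repeatedly, until [j] reaches [p]. *)
Lemma colon_expansion (A : comNzRingType) (p : nat) (K G : set A) (y : A) :
  is_ideal K -> is_ideal G -> G `<=` K ->
  (forall j f, (j < p)%N -> K (y ^+ j * f) -> adjoin G y f) ->
  K `<=` adjoin G (y ^+ p).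
Proof.
move=> K_id G_id GK colon f Kf.
suff H j : (j <= p)%N -> adjoin G (y ^+ j) f by exact: H.
elim: j => [|j IH] jp.
  by exists 0, f; rewrite mulr1 add0r; split=> //; exact: ideal_zero.
have [g [c [Gg fE]]] := IH (ltnW jp).
have /(colon _ _ jp)[g' [c' [Gg' cE]]] : K (y ^+ j * c).
  have -> : y ^+ j * c = f - g by rewrite fE; ring.
  by apply: ideal_sub => //; exact: GK.
exists (g + g' * y ^+ j), c'; split; last by rewrite fE cE exprS; ring.
by apply: ideal_add => //; exact: ideal_mulr.
Qed.

Lemma preimage_ideal (A B : comNzRingType) (phi : {rmorphism A -> B})
    (J : set B) : is_ideal J -> is_ideal (phi @^-1` J).
Proof.
move=> J_id; split=> [|a b Ja Jb|a b Jb]; rewrite /preimage /=.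
- by rewrite rmorph0; exact: ideal_zero.
- by rewrite rmorphD; exact: ideal_add.
- by rewrite rmorphM; exact: ideal_mull.
Qed.

(** These interpolate between generators of [m], when [s] is a full chain, and the
    desired generators of the kernel, when [s] is empty. The predicate [P]
    marks the generators that occur through a [p]-th power in the latter. *)
Definition mixed_power (A : comNzRingType) (T : eqType) (p : nat) (P : pred T)
    (x : T -> A) (s : seq T) (i : T) : A :=
  if (i \in s) || ~~ P i then x i else x i ^+ p.

(** Removing the last generator [y] adjoined to the chain replaces [y] with
    [y^p] among the generators of the preimage, by [colon_expansion]. *)
Lemma regular_chain_kernel (A B : comNzRingType) (phi : {rmorphism A -> B})
    (T : eqType) (p : nat) (P : pred T) (x : T -> A) (s : seq T) :
  (0 < p)%N -> (forall i, phi (x i) ^+ p = 0) ->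
  (forall i, ~~ P i -> phi (x i) = 0) ->
  p_regular p (phi \o x) s ->
  phi @^-1` (chain (phi \o x) s) `<=`
    ideal_gen (range (mixed_power p P x s)) ->
  phi @^-1` [set 0] `<=` ideal_gen (range (mixed_power p P x [::])).
Proof.
move=> p_gt0 xp0 xP0; elim: s => [//|i s IH] [colon reg] top.
apply: (IH reg); set G := ideal_gen _; set K := phi @^-1` _.
have G_id : is_ideal G by exact: ideal_gen_ideal.
have c_id := chain_ideal (phi \o x) s.
have K_id : is_ideal K by exact: preimage_ideal.
have Gmem j : G (mixed_power p P x s j) by apply: sub_ideal_gen; exists j.
have GK : G `<=` K.
  apply: ideal_gen_min => // _ [j _ <-]; rewrite /K /preimage /= /mixed_power.
  case: ifP => [/orP[js|/xP0 ->]|_]; first exact: (chain_mem (phi \o x)).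
    exact: ideal_zero.
  by rewrite rmorphXn xp0; exact: ideal_zero.
have KGp : K `<=` adjoin G (x i ^+ p).
  apply: colon_expansion => // j f jp Kf.
  have /top : (phi @^-1` chain (phi \o x) (i :: s)) f.
    by apply: (colon j) => //; move: Kf; rewrite /K /preimage /= rmorphM rmorphXn.
  apply: ideal_gen_min; first exact: adjoin_ideal.
  move=> _ [k _ <-]; rewrite /mixed_power in_cons.
  have [->|_] := eqVneq k i; first exact: adjoin_self.
  by apply: sub_adjoin; exact: Gmem.
apply: (subset_trans KGp); apply: adjoin_min => //.
have := Gmem i; rewrite /mixed_power; case: ifP => // _ Gx.
by rewrite -(prednK p_gt0) exprS; exact: (ideal_mulr _ G_id).
Qed.

Lemma image_ideal (A B : comNzRingType) (phi : {rmorphism A -> B}) (J : set A) :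
  (forall b, exists a, phi a = b) -> is_ideal J -> is_ideal (phi @` J).
Proof.
move=> surj J_id; split.
- by exists 0; [exact: ideal_zero|rewrite rmorph0].
- move=> _ _ [a Ja <-] [b Jb <-]; exists (a + b); rewrite ?rmorphD //.
  exact: ideal_add.
- move=> c _ [b Jb <-]; have [a <-] := surj c.
  by exists (a * b); rewrite ?rmorphM //; exact: ideal_mull.
Qed.

Lemma ideal_gen_image (A B : comNzRingType) (phi : {rmorphism A -> B})
    (S : set A) : (forall b, exists a, phi a = b) ->
  ideal_gen (phi @` S) = phi @` ideal_gen S.
Proof.
move=> surj; apply/seteqP; split.
  apply: ideal_gen_min; first by apply: image_ideal => //; exact: ideal_gen_ideal.
  by apply: image_subset; exact: sub_ideal_gen.
move=> _ [a + <-]; move: a; apply: ideal_gen_min.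
  by apply: preimage_ideal; exact: ideal_gen_ideal.
by move=> a Sa; apply: sub_ideal_gen; exists a.
Qed.

(** * Local rings *)

(** Characterizes [n] as the unique maximal ideal without quantifying over other
    ideals. *)
Definition ideal_of_nonunits (B : comNzRingType) (n : set B) : Prop :=
  [/\ is_ideal n, ~ n 1 & forall a, ~ n a -> exists b, a * b = 1].

(** A nonunit lies in a maximal ideal, by Zorn's lemma. *)
Lemma local_ring_nonunits (B : comNzRingType) (m : set B) :
  local_ring m -> ideal_of_nonunits m.
Proof.
move=> loc; have [m_id mT m_max] : maximal_ideal m by apply/loc.
split=> //; first exact: ideal_proper.
move=> a ma; apply: contrapT => nunit.
pose C (J : set B) := J = set0 \/ [/\ is_ideal J, J a & ~ J 1].
have [|M [CM Mmax]] := @Zorn_bigcup B C.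
  move=> F FC Ftot.
  have [[X FX [X_id Xa X1]]|no] :=
      pselect (exists2 X, F X & [/\ is_ideal X, X a & ~ X 1]); last first.
    left; apply/seteqP; split=> // b [X FX Xb].
    by have [X0|X_id] := FC _ FX; [rewrite X0 in Xb|case: no; exists X].
  right; split.
  - split; first by exists X => //; exact: ideal_zero.
      move=> b c [Y FY Yb] [Z FZ Zc].
      have Y_id : is_ideal Y by case: (FC _ FY) => [Y0|[]//]; rewrite Y0 in Yb.
      have Z_id : is_ideal Z by case: (FC _ FZ) => [Z0|[]//]; rewrite Z0 in Zc.
      by case: (Ftot _ _ FY FZ) => [YZ|ZY]; [exists Z|exists Y] => //;
         apply: ideal_add => //; [exact: YZ|exact: ZY].
    move=> b c [Y FY Yc]; exists Y => //; apply: ideal_mull => //.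
    by case: (FC _ FY) => [Y0|[]//]; rewrite Y0 in Yc.
  - by exists X.
  - move=> [Y FY Y1]; case: (FC _ FY) => [Y0|[]//]; by rewrite Y0 in Y1.
have a_id := adjoin_ideal a (zero_ideal B).
have Ca : C (adjoin [set 0] a).
  right; split=> //; first exact: adjoin_self (zero_ideal B).
  move=> [_ [c [-> e]]]; apply: nunit; exists c.
  by rewrite e add0r mulrC.
have [M0|[M_id Ma M1]] := CM.
  apply: (Mmax _ _ Ca); rewrite M0; split=> // /(_ a) H.
  by apply: H; apply: adjoin_self; exact: zero_ideal.
suff Mm : maximal_ideal M by move/loc: Mm => Mm; rewrite Mm in Ma.
split=> //; first by move=> MT; apply: M1; rewrite MT.
move=> J J_id MJ.
have [J1|J1] := pselect (J 1); first by right; exact: ideal_top.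
left; apply/seteqP; split=> //; apply: contrapT => JM.
by apply: (Mmax J); [split|right; split=> //; exact: MJ].
Qed.

Lemma nonunits_maximal (B : comNzRingType) (n : set B) :
  ideal_of_nonunits n -> xget set0 (@maximal_ideal B) = n.
Proof.
move=> [n_id n1 n_unit].
have sub_n J : is_ideal J -> ~ J 1 -> J `<=` n.
  move=> J_id J1 a Ja; apply: contrapT => /n_unit[b ab]; apply: J1.
  by rewrite -ab; exact: ideal_mulr.
apply: xget_unique.
  split=> //; first by move=> nT; apply: n1; rewrite nT.
  move=> J J_id nJ; have [J1|J1] := pselect (J 1).
    by right; exact: ideal_top.
  by left; apply/seteqP; split=> //; exact: sub_n.
move=> M [M_id MT M_max].
have Mn : M `<=` n by apply: sub_n => //; exact: ideal_proper.
by have [->//|nT] := M_max n n_id Mn; case: n1; rewrite nT.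
Qed.

Lemma nonunits_image (A B : comNzRingType) (phi : {rmorphism A -> B})
    (m : set A) : (forall b, exists a, phi a = b) ->
  phi @^-1` [set 0] `<=` m -> ideal_of_nonunits m ->
  ideal_of_nonunits (phi @` m).
Proof.
move=> surj ker_m [m_id m1 m_unit]; split; first exact: image_ideal.
  move=> [a ma a1]; apply: m1; rewrite -[1](subrKC a); apply: ideal_add => //.
  by apply: ker_m; rewrite /preimage /= rmorphB rmorph1 a1 subrr.
move=> b nb; have [a ab] := surj b.
have [|c ac] := m_unit a; first by move=> ma; apply: nb; exists a.
by exists (phi c); rewrite -ab -rmorphM ac rmorph1.
Qed.

(** * Irredundant generators of ideals in local rings *)

Definition rem_nth (B : Type) (i : nat) (s : seq B) : seq B :=
  take i s ++ drop i.+1 s.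

Lemma size_rem_nth (B : Type) i (s : seq B) :
  (i < size s)%N -> size (rem_nth i s) = (size s).-1.
Proof.
move=> i_s; rewrite size_cat size_take i_s size_drop.
by rewrite -[in RHS](subnKC i_s).
Qed.

Lemma map_rem_nth (B C : Type) (f : B -> C) i s :
  map f (rem_nth i s) = rem_nth i (map f s).
Proof. by rewrite map_cat map_take map_drop. Qed.

Lemma rem_nth_cat (B : Type) i (s t : seq B) :
  rem_nth i (s ++ t) =
    if (i < size s)%N then rem_nth i s ++ t else s ++ rem_nth (i - size s) t.
Proof.
rewrite /rem_nth take_cat drop_cat; have [i_s|s_i] := ltnP i (size s).
  rewrite -catA; congr (_ ++ _); case: ltnP => // s_i.
  have -> : i.+1 = size s by apply/eqP; rewrite eqn_leq i_s.
  by rewrite subnn drop0 drop_size.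
by rewrite ltnNge (leq_trans s_i) //= -catA subSn.
Qed.

Lemma rem_nth_sub (B : eqType) i (s : seq B) : {subset rem_nth i s <= s}.
Proof. by move=> a; rewrite mem_cat => /orP[/mem_take|/mem_drop]. Qed.

Lemma mem_rem_nth (B : eqType) x0 i j (s : seq B) :
  (j < size s)%N -> j != i -> nth x0 s j \in rem_nth i s.
Proof.
move=> js; rewrite mem_cat neq_ltn => /orP[ji|ij]; apply/orP; [left|right].
  rewrite -(nth_take _ ji); apply: mem_nth.
  by rewrite size_take; case: ifP.
rewrite -(subnKC ij) -nth_drop; apply: mem_nth.
by rewrite size_drop ltn_sub2r // (leq_ltn_trans ij).
Qed.

Lemma ideal_gen_rem_nth (B : comNzRingType) i (s : seq B) :
  ideal_gen [set` rem_nth i s] s`_i ->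
  ideal_gen [set` rem_nth i s] = ideal_gen [set` s].
Proof.
move=> si; apply/seteqP; split.
  by apply: ideal_gen_sub => a; exact: rem_nth_sub.
apply: ideal_gen_min; first exact: ideal_gen_ideal.
move=> _ /= /(nthP 0)[j js <-]; have [->//|ji] := eqVneq j i.
by apply: sub_ideal_gen; exact: mem_rem_nth.
Qed.

Lemma generated_by_seq (B : comNzRingType) (J : set B) k :
  generated_by_n J k <-> exists2 s : seq B, size s = k & ideal_gen [set` s] = J.
Proof.
split=> [[x <-]|[s <- <-]].
  exists (codom x); first by rewrite size_codom card_ord.
  congr ideal_gen; apply/seteqP; split=> [_ /codomP[i ->]|_ [i _ <-]] /=.
    by exists i.
  exact: codom_f.
exists (fun i => s`_i); congr ideal_gen; apply/seteqP; split.
  by move=> _ [i _ <-] /=; exact: mem_nth.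
by move=> a /(nthP 0)[i i_s <-]; exists (Ordinal i_s).
Qed.

(** The default value [0] of [nth] makes the bound [k] flexible. *)
Lemma ideal_gen_comb (B : comNzRingType) (s : seq B) k a :
  (size s <= k)%N -> ideal_gen [set` s] a ->
  exists c : 'I_k -> B, a = \sum_i c i * s`_i.
Proof.
move=> sk; pose J := [set a | exists c : 'I_k -> B, a = \sum_i c i * s`_i].
suff J_id : is_ideal J.
  move=> sa; apply: (ideal_gen_min J_id _ sa) => _ /(nthP 0)[j js <-].
  exists (fun i => (val i == j)%:R).
  rewrite (bigD1 (Ordinal (leq_trans js sk))) //= eqxx mul1r big1 ?addr0 //.
  by move=> i /negPf ij; rewrite -val_eqE /= in ij; rewrite ij mul0r.
split.
- by exists (fun=> 0); rewrite big1 // => i _; rewrite mul0r.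
- move=> a1 a2 [c ->] [c' ->]; exists (fun i => c i + c' i).
  by rewrite -big_split; apply: eq_bigr => i _; rewrite mulrDl.
- move=> b a1 [c ->]; exists (fun i => b * c i).
  by rewrite mulr_sumr; apply: eq_bigr => i _; rewrite mulrA.
Qed.

Lemma det_congr (B : comNzRingType) (J : set B) k (M N : 'M[B]_k) :
  is_ideal J -> (forall i j, J (M i j - N i j)) -> J (\det M - \det N).
Proof.
move=> J_id MN; rewrite /determinant.
pose R a b := J (a - b).
have R_add a b c d : R a b -> R c d -> R (a + c) (b + d).
  by move=> ab cd; rewrite /R opprD addrACA; exact: ideal_add.
have R_mul a b c d : R a b -> R c d -> R (a * c) (b * d).
  move=> ab cd; rewrite /R.
  have -> : a * c - b * d = a * (c - d) + d * (a - b) by ring.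
  by apply: ideal_add => //; exact: ideal_mull.
have R_refl a : R a a by rewrite /R subrr; exact: ideal_zero.
apply: (big_ind2 R (R_refl 0) R_add) => s _; apply: (R_mul _ _ _ _ (R_refl _)).
by apply: (big_ind2 R (R_refl 1) R_mul) => i _; exact: MN.
Qed.

Definition irredundant (B : comNzRingType) (s : seq B) : Prop :=
  forall i, (i < size s)%N -> ~ ideal_gen [set` rem_nth i s] s`_i.

(** The exchange theorem. If [u = P w] and [w = Q u], then [(1 - P Q) u = 0],
    and irredundance of [u] forces the entries of [1 - P Q] to be nonunits, so
    [det (P Q)] is congruent to [1]. If [w] were shorter than [u], padding it
    with [0] would give a square [Q] with a zero row. *)
Lemma irredundant_size_le (B : comNzRingType) (n : set B) (u w : seq B) :
  ideal_of_nonunits n -> irredundant u ->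
  ideal_gen [set` u] = ideal_gen [set` w] -> (size u <= size w)%N.
Proof.
move=> [n_id n1 n_unit] u_irr uw; rewrite leqNgt; apply/negP => wu.
have /choice[P uP] : forall i : 'I_(size u),
    exists c : 'I_(size u) -> B, u`_i = \sum_j c j * w`_j.
  move=> i; apply: ideal_gen_comb; first exact: ltnW.
  by rewrite -uw; apply: sub_ideal_gen; exact: mem_nth.
have /choice[Q wQ] : forall j : 'I_(size u), exists c : 'I_(size u) -> B,
    w`_j = \sum_i c i * u`_i /\ ((size w <= j)%N -> forall i, c i = 0).
  move=> j; have [wj|jw] := leqP (size w) j.
    exists (fun=> 0); split=> //; rewrite nth_default // big1 // => i _.
    by rewrite mul0r.
  have [|c ->] := @ideal_gen_comb B u (size u) w`_j (leqnn _).
    by rewrite uw; apply: sub_ideal_gen; exact: mem_nth.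
  by exists c.
pose MP := \matrix_(i, j) P i j; pose MQ := \matrix_(j, i) Q j i.
have PQ_u i : \sum_i' (MP *m MQ) i i' * u`_i' = u`_i.
  rewrite (uP i); under eq_bigr => i' _ do rewrite mxE mulr_suml.
  rewrite exchange_big; apply: eq_bigr => j _ /=.
  rewrite (wQ j).1 mulr_sumr; apply: eq_bigr => i' _.
  by rewrite !mxE mulrA.
have PQ1 i j : n ((1%:M : 'M_(size u)) i j - (MP *m MQ) i j).
  apply: contrapT => /n_unit[v]; set N := _ - _ => Nv.
  apply: (u_irr j (ltn_ord j)).
  have Nu : \sum_k ((1%:M : 'M_(size u)) i k - (MP *m MQ) i k) * u`_k = 0.
    under eq_bigr => k _ do rewrite mulrBl.
    rewrite sumrB PQ_u (bigD1 i) //= mxE eqxx mul1r big1 ?addr0 ?subrr //.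
    by move=> k /negPf ki; rewrite mxE eq_sym ki mul0r.
  move: Nu; rewrite (bigD1 j) //= -/N; set S := \sum_(k | _) _ => Nu.
  have -> : u`_j = - v * S.
    transitivity ((N * v) * u`_j); first by rewrite Nv mul1r.
    move/eqP: Nu; rewrite addr_eq0 => /eqP NuS.
    by rewrite -[N * v]mulrC -mulrA NuS; ring.
  have R_id := ideal_gen_ideal [set` rem_nth j u].
  apply: (ideal_mull _ R_id); apply: (big_ind (ideal_gen [set` rem_nth j u])).
  - exact: ideal_zero R_id.
  - by move=> a b; exact: ideal_add R_id.
  - move=> k kj; apply: (ideal_mull _ R_id); apply: sub_ideal_gen.
    by apply: mem_rem_nth; rewrite ?ltn_ord //; move: kj; rewrite -val_eqE.
apply: n1; have := det_congr n_id PQ1; rewrite det1 det_mulmx.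
suff -> : \det MQ = 0 by rewrite mulr0 subr0.
rewrite (expand_det_row _ (Ordinal wu)) big1 // => i _.
by rewrite mxE (wQ _).2 ?mul0r.
Qed.

Lemma min_number_gensP (B : comNzRingType) (J : set B) k :
  generated_by_n J k ->
  generated_by_n J (min_number_gens J) /\
  forall j, generated_by_n J j -> (min_number_gens J <= j)%N.
Proof.
move=> Jk; apply: (@xgetPex _ 0%N
  [set k | generated_by_n J k /\ forall j, generated_by_n J j -> (k <= j)%N]).
have exJ : exists k, `[<generated_by_n J k>] by exists k; exact/asboolP.
exists (ex_minn exJ); case: ex_minnP => j /asboolP Jj jmin.
by split=> // i Ji; apply: jmin; exact/asboolP.
Qed.

Lemma emdimP (B : comNzRingType) (n : set B) (s : seq B) :
  ideal_of_nonunits n -> ideal_gen [set` s] = n ->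
  (exists2 t : seq B, size t = emdim B & ideal_gen [set` t] = n) /\
  forall t : seq B, ideal_gen [set` t] = n -> (emdim B <= size t)%N.
Proof.
move=> n_loc sn; rewrite /emdim (nonunits_maximal n_loc).
have [|nmin minn] := @min_number_gensP B n (size s).
  by apply/generated_by_seq; exists s.
split; first exact/generated_by_seq.
by move=> t tn; apply: minn; apply/generated_by_seq; exists t.
Qed.

(** Lift a minimal generating list of the maximal ideal of [B] to [A] and
    complete it to generators of [m] with as few elements of the kernel as
    possible. No element of the resulting list is redundant: for the lifted
    part this is already so in [B]. *)
Lemma adapted_generators (A B : comNzRingType) (phi : {rmorphism A -> B})
    (m : set A) (s : seq A) :
  (forall b, exists a, phi a = b) -> ideal_of_nonunits m ->
  phi @^-1` [set 0] `<=` m -> ideal_gen [set` s] = m ->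
  exists u : seq A,
    [/\ size u = emdim A /\ ideal_gen [set` u] = m, (emdim B <= emdim A)%N,
        irredundant u,
        forall i, (emdim B <= i)%N -> phi u`_i = 0 &
        forall i, (i < emdim B)%N ->
          ~ ideal_gen [set` map phi (rem_nth i u)] (phi u`_i)].
Proof.
move=> surj m_loc ker_m sm; have [m_id _ _] := m_loc.
have N_loc := nonunits_image surj ker_m m_loc; set N := phi @` m in N_loc.
have map_set (t : seq A) : [set` map phi t] = phi @` [set` t].
  by apply/seteqP; split=> [_ /mapP[a ta ->]|_ [a ta <-]] /=;
     [exists a|exact: map_f].
have gen_map (t : seq A) :
    ideal_gen [set` map phi t] = phi @` ideal_gen [set` t].
  by rewrite map_set ideal_gen_image.
have sN : ideal_gen [set` map phi s] = N by rewrite gen_map sm.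
have [[v vr vN] rmin] := emdimP N_loc sN.
have [[w wn wm] nmin] := emdimP m_loc sm.
have /choice[g gK] := surj.
pose s0 := map g v.
have s0v : map phi s0 = v.
  by rewrite -map_comp -[RHS]map_id; apply: eq_map => b /=; rewrite gK.
have s0r : size s0 = emdim B by rewrite size_map.
have s0m a : ideal_gen [set` s0] a -> m a.
  move=> s0a; have : N (phi a) by rewrite -vN -s0v gen_map; exists a.
  move=> [b mb ba]; rewrite -[a](subrKC b); apply: ideal_add => //.
  by apply: ker_m; rewrite /preimage /= rmorphB ba subrr.
pose good k := exists t : seq A, [/\ size t = k,
  forall a, a \in t -> phi a = 0 & ideal_gen [set` s0 ++ t] = m].
have [k0 good_k0] : exists k, good k.
  have /choice[h hP] : forall z, exists h,
      m z -> phi h = 0 /\ ideal_gen [set` s0] (z - h).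
    move=> z; have [mz|nmz] := pselect (m z); last by exists 0.
    have : N (phi z) by exists z.
    rewrite -vN -s0v gen_map => -[z' s0z' z'z]; exists (z - z') => _.
    by rewrite rmorphB z'z subrr opprB subrKC.
  have ms z : z \in s -> m z by move=> zs; rewrite -sm; exact: sub_ideal_gen.
  exists (size (map h s)), (map h s); split=> //.
    by move=> _ /mapP[z /ms mz ->]; case: (hP z mz).
  apply/seteqP; split.
    apply: ideal_gen_min => // a /=; rewrite mem_cat => /orP[s0a|].
      by apply: s0m; exact: sub_ideal_gen.
    by move=> /mapP[z /ms mz ->]; apply: ker_m; case: (hP z mz).
  rewrite -sm; apply: ideal_gen_min; first exact: ideal_gen_ideal.
  move=> z zs; have [_ s0z] := hP z (ms z zs).
  rewrite -[z](subrK (h z)); apply: (ideal_add (ideal_gen_ideal _)).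
    by apply: ideal_gen_sub s0z => a /= s0a; rewrite mem_cat s0a.
  by apply: sub_ideal_gen; rewrite /= mem_cat map_f ?orbT.
have good_ex : exists k, `[<good k>] by exists k0; exact/asboolP.
case: (ex_minnP good_ex) => k /asboolP[t [tk t0 tm]] kmin.
have B_irr i : (i < emdim B)%N ->
    ~ ideal_gen [set` map phi (rem_nth i (s0 ++ t))] (phi (s0 ++ t)`_i).
  move=> ir; rewrite rem_nth_cat nth_cat s0r ir map_cat => ri.
  have vi : phi s0`_i = v`_i.
    by rewrite -[in RHS]s0v [RHS](nth_map 0) ?s0r.
  have {}ri : ideal_gen [set` rem_nth i v] v`_i.
    move: ri; rewrite vi map_rem_nth s0v; apply: ideal_gen_min.
      exact: ideal_gen_ideal.
    move=> b /=; rewrite mem_cat => /orP[|/mapP[a /t0 -> ->]].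
      by move=> vb; apply: sub_ideal_gen.
    exact: (ideal_zero (ideal_gen_ideal _)).
  have /rmin : ideal_gen [set` rem_nth i v] = N by rewrite ideal_gen_rem_nth.
  by rewrite size_rem_nth vr // leqNgt ltn_predL (leq_ltn_trans _ ir).
have u_irr : irredundant (s0 ++ t).
  move=> i; rewrite size_cat s0r => i_u ui; have [ir|ri] := ltnP i (emdim B).
    by apply: (B_irr i ir); rewrite gen_map; exists ((s0 ++ t)`_i).
  have it : (i - emdim B < size t)%N by rewrite ltn_subLR.
  have := ideal_gen_rem_nth ui.
  rewrite tm rem_nth_cat s0r ltnNge ri /= => rm.
  have /asboolP/kmin : good (size t).-1.
    exists (rem_nth (i - emdim B) t); rewrite size_rem_nth //; split=> //.
    by move=> a /rem_nth_sub; exact: t0.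
  by rewrite -tk leqNgt ltn_predL (leq_ltn_trans _ it).
have un : size (s0 ++ t) = emdim A.
  apply/eqP; rewrite eqn_leq nmin // andbT -wn.
  by apply: (irredundant_size_le m_loc u_irr); rewrite tm wm.
exists (s0 ++ t); split=> //; first by rewrite -un size_cat s0r leq_addr.
move=> i ri; rewrite nth_cat s0r ltnNge ri /=.
have [it|ti] := ltnP (i - emdim B) (size t); first by apply: t0; exact: mem_nth.
by rewrite nth_default // rmorph0.
Qed.

(** * Characteristic and differential simplicity of the quotient *)

Lemma der_natr (B : comNzRingType) (d : B -> B) k :
  derivation d -> d k%:R = 0.
Proof.
by move=> dd; elim: k => [|k IH]; rewrite ?der0 // mulrS dd.1 der1 // IH addr0.
Qed.

(** Every [q%:R] generates an ideal stable under all derivations; for a prime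
    factor [q] of the characteristic [p] it is not a unit, since [p/q] is not
    zero in [B], so it is zero. *)
Lemma diff_simple_char_prime (B : comNzRingType) p :
  diff_simple [set 0 : B] -> (0 < p)%N -> has_char B p -> prime p.
Proof.
move=> [z_id _ simp] p_gt0 chp.
have p_gt1 : (1 < p)%N.
  rewrite ltn_neqAle p_gt0 andbT; apply/eqP => p1.
  have /chp/eqP : (p %| 1)%N by rewrite -p1.
  by rewrite oner_eq0.
have q_pr := pdiv_prime p_gt1; set q := pdiv p in q_pr.
have [s ps] : exists s, p = (s * q)%N by apply/dvdnP; exact: pdiv_dvd.
case: (simp (adjoin [set 0] q%:R)) => [||d dd _|q0|q1].
- exact: adjoin_ideal.
- exact: sub_adjoin.
- move=> _ [_ [c [-> ->]]]; rewrite add0r dd.2 der_natr // mulr0 add0r mulrC.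
  exact: adjoinM.
- have /q0 /= /chp pq : adjoin [set 0 : B] q%:R q%:R by exact: adjoin_self.
  have /eqP -> // : p == q by rewrite eqn_dvd pq pdiv_dvd.
- have [_ [c [-> ]]] := q1; rewrite add0r => c1.
  have s_gt0 : (0 < s)%N by move: p_gt0; rewrite ps muln_gt0 => /andP[].
  have /chp/dvdn_leq : s%:R = 0 :> B.
    transitivity (c * (s%:R * q%:R)); first by rewrite mulrCA -c1 mulr1.
    by rewrite -natrM -ps; have /chp -> := dvdnn p; rewrite mulr0.
  by move=> /(_ s_gt0); rewrite leqNgt ps ltn_Pmulr // prime_gt1.
Qed.

(** Each derivation in [D] preserves the kernel, hence descends to [B]. *)
Lemma diff_simple_quotient (A B : comNzRingType) (phi : {rmorphism A -> B})
    (D : set {additive A -> A}) :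
  (forall b, exists a, phi a = b) -> (forall d, D d -> is_derivation d) ->
  maximally_differential D (phi @^-1` [set 0]) -> diff_simple [set 0 : B].
Proof.
move=> surj der_D [_ _ kerD kermax].
split; [exact: zero_ideal|by apply/eqP; rewrite oner_eq0|].
move=> J J_id _ stabJ; have J0 := ideal_zero J_id.
have [kerJ|Jker] := pselect (phi @^-1` J `<=` phi @^-1` [set 0]).
  by left=> b; have [a <-] := surj b; exact: kerJ.
right; apply: contrapT => J1.
have preJ_id := preimage_ideal phi J_id.
apply: (kermax (phi @^-1` J)) => //.
- by split=> // a; rewrite /preimage /= => ->.
- split=> // /(_ 1 I); rewrite /preimage /= rmorph1; exact: J1.
move=> d Dd _ [a Ja <-].
have /choice[g gK] := surj.
have d_ker x y : phi x = phi y -> phi (d x) = phi (d y).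
  move=> xy; apply/eqP; rewrite -subr_eq0 -rmorphB -raddfB; apply/eqP.
  apply: (kerD d Dd); exists (x - y) => //.
  by rewrite /preimage /= rmorphB xy subrr.
have dbar : derivation (fun b => phi (d (g b))).
  split=> b c.
    by rewrite -rmorphD -raddfD; apply: d_ker; rewrite rmorphD !gK.
  transitivity (phi (d (g b * g c))); first by apply: d_ker; rewrite rmorphM !gK.
  by rewrite der_D // rmorphD !rmorphM !gK.
have : stable (fun b => phi (d (g b))) J.
  apply: stabJ => // _ ->; rewrite /= -(raddf0 phi) -(raddf0 d).
  by apply: d_ker; rewrite gK raddf0.
move=> /(_ _ Ja); rewrite /preimage /=; congr (J _).
by apply: d_ker; rewrite gK.
Qed.

(** * Generators of a maximally differential ideal *)

(** [A/I] enters only through a surjection [phi] with kernel [I], so the argument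
    does not depend on how the quotient is constructed. *)
Lemma maximally_differential_generators (A B : comNzRingType)
    (phi : {rmorphism A -> B}) (m : set A) (D : set {additive A -> A}) p :
  (forall b, exists a, phi a = b) ->
  noetherian A -> local_ring m -> (forall d, D d -> is_derivation d) ->
  maximally_differential D (phi @^-1` [set 0]) ->
  (0 < p)%N -> has_char B p ->
  (emdim B <= emdim A)%N /\
  exists x : 'I_(emdim A) -> A,
    [/\ injective x, minimal_gen_set m (range x) &
        phi @^-1` [set 0] =
          ideal_gen ([set x i ^+ p | i in [set i : 'I_(emdim A) | (i < emdim B)%N]]
             `|` [set x i | i in [set i : 'I_(emdim A) | (emdim B <= i)%N]])].
Proof.
move=> surj noeth loc der_D max_ker p_gt0 chp.
have simp := diff_simple_quotient surj der_D max_ker.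
have p_pr := diff_simple_char_prime simp p_gt0 chp.
have p0 : p%:R = 0 :> B by apply/chp.
have m_loc := local_ring_nonunits loc; have [m_id m1 m_unit] := m_loc.
have [ker_id kerT _ _] := max_ker.
have ker_m : phi @^-1` [set 0] `<=` m.
  move=> a a0; apply: contrapT => /m_unit[b ab].
  by apply: (ideal_proper ker_id kerT); rewrite -ab; exact: ideal_mulr.
have [_ [/finite_seqP[s ->] sm]] := noeth m m_id.
have [u [[un um] rn u_irr u_ker B_irr]] := adapted_generators surj m_loc ker_m sm.
have [N_id N1 N_unit] := nonunits_image surj ker_m m_loc.
split=> //; pose x (i : 'I_(emdim A)) := u`_i; exists x.
have range_x : range x = [set` u].
  apply/seteqP; split=> [_ [i _ <-]|a /(nthP 0)[i iu <-]].
    by apply: mem_nth; rewrite un.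
  by rewrite un in iu; exists (Ordinal iu).
have xp0 i : phi (x i) ^+ p = 0.
  apply: (simple_expp p0 p_gt0 simp N_id N1); exists (x i) => //.
  by rewrite -um -range_x; apply: sub_ideal_gen; exists i.
pose P (i : 'I_(emdim A)) := (i < emdim B)%N.
have xP0 i : ~~ P i -> phi (x i) = 0 by rewrite -leqNgt => /u_ker.
split.
- move=> i j xij; apply: contrapT => ij.
  have i_u : (i < size u)%N by rewrite un.
  have j_u : (j < size u)%N by rewrite un.
  apply: (u_irr i i_u); rewrite -/(x i) xij; apply: sub_ideal_gen.
  by apply: mem_rem_nth => //; apply/eqP => ji; apply: ij; exact/esym/val_inj.
- split; first by rewrite range_x.
  move=> T [Tx xT] Tm; apply: xT => _ [i _ <-]; apply: contrapT => Ti.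
  have i_u : (i < size u)%N by rewrite un.
  apply: (u_irr i i_u).
  have : ideal_gen T u`_i by rewrite Tm -um; apply: sub_ideal_gen; exact: mem_nth.
  apply: ideal_gen_sub => a Ta; have [j _ xja] := Tx a Ta.
  rewrite -xja; apply: mem_rem_nth; first by rewrite un.
  by apply/eqP => /val_inj ji; apply: Ti; rewrite -ji xja.
- apply/seteqP; split; last first.
    apply: ideal_gen_min => // _ [[i _ <-]|[i /= ri <-]]; rewrite /preimage /=.
      by rewrite rmorphXn xp0.
    exact: u_ker.
  have gen_b : ideal_gen (range (phi \o x)) = phi @` m.
    by rewrite -um -range_x -ideal_gen_image // image_comp.
  have [c [_ c_reg cN]] := p_regular_chain p_pr p0 simp N_id N1 N_unit gen_b.
  have Pc i : P i -> i \in c.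
    move=> Pi; apply: contrapT => ic; apply: (B_irr i Pi).
    have : chain (phi \o x) c (phi (x i)).
      rewrite cN; exists (x i) => //.
      by rewrite -um -range_x; apply: sub_ideal_gen; exists i.
    apply: chain_min; first exact: ideal_gen_ideal.
    move=> j jc; apply: sub_ideal_gen; apply: map_f; apply: mem_rem_nth.
      by rewrite un.
    by apply: contra_notN ic => /eqP/val_inj <-.
  have top : phi @^-1` chain (phi \o x) c `<=`
      ideal_gen (range (mixed_power p P x c)).
    rewrite cN => a [a' ma' aa'].
    have : m a by rewrite -[a](subrK a'); apply: ideal_add => //;
      apply: ker_m; rewrite /preimage /= rmorphB aa' subrr.
    rewrite -um -range_x; apply: ideal_gen_sub => _ [i _ <-]; exists i => //.
    rewrite /mixed_power; case: ifP => // /negP; case.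
    by case: (boolP (P i)) => [/Pc->|_]; rewrite ?orbT.
  have := regular_chain_kernel p_gt0 xp0 xP0 c_reg top.
  move=> /subset_trans; apply; apply: ideal_gen_sub => _ [i _ <-].
  rewrite /mixed_power in_nil /= /P -leqNgt.
  by case: leqP => ir; [right|left]; exists i.
Qed.

Theorem theorem2 (A : comNzRingType) (m : set A)
    (hnoeth : noetherian A) (hlocal : local_ring m)
    (D : set {additive A -> A}) (hD : forall d, D d -> is_derivation d)
    (I : idealr A) (hI : maximally_differential D [set` I])
    (n : nat) (hn : n = emdim A)
    (r : nat) (hr : r = emdim {ideal_quot I})
    (p : nat) (hp : (0 < p)%N) (hchar : has_char {ideal_quot I} p) :
  (r <= n)%N /\
  exists x : 'I_n -> A,
    [/\ injective x,
        minimal_gen_set m (range x) &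
        [set` I] = ideal_gen ([set x i ^+ p | i in [set i : 'I_n | (i < r)%N]]
                          `|` [set x i | i in [set i : 'I_n | (r <= i)%N]])].
Proof.
pose phi : {rmorphism A -> {ideal_quot I}} := \pi_{ideal_quot I}%qT.
have surj b : exists a, phi a = b by exists (repr b); exact: reprK.
have memI a : (a \in I) = (phi a == 0).
  by rewrite -(rmorph0 phi) -[a in LHS]subr0 Quotient.idealrBE.
have kerI : [set` I] = phi @^-1` [set 0].
  by apply/seteqP; split=> a; rewrite /preimage /= memI => /eqP.
rewrite kerI in hI *; rewrite hn hr.
exact: (maximally_differential_generators surj hnoeth hlocal hD hI hp hchar).
Qed.
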